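(* For every $k$ that is a power of $4$, there is a $k$-blocked set of exactly $k^{\log_4 12}=k^{1.79\ldots}$ points.
   Context: All point sets are finite subsets of the Euclidean plane. A point $x$ blocks two points $v$ and $w$ if $x$ is in the interior of the line segment $\overline{vw}$. Two points $v,w$ are visible with respect to a point set $P$ if no point in $P$ blocks $v$ and $w$. A point set $P$ is $k$-blocked if each point in $P$ is assigned one of $k$ colours such that each pair of distinct points $v,w\in P$ are visible with respect to $P$ if and only if $v$ and $w$ are coloured differently. *)

(* Defs.v *)
(* The Euclidean plane is 'rV[R]_2 with R : realType. *)
From mathcomp Require Import all_boot all_order all_algebra.
From mathcomp Require Import finmap.
From mathcomp Require Import reals exp.

Set Implicit Arguments.
Unset Strict Implicit.
Unset Printing Implicit Defensive.

Import Order.TTheory GRing.Theory Num.Theory.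

Local Open Scope ring_scope.

Section BlockedSets.
Context {R : realType}.
Implicit Types (v w x : 'rV[R]_2) (P : {fset 'rV[R]_2}).

(* Only applied below to distinct v and w, so the segment is nondegenerate. *)
Definition blocks x v w : Prop :=
  exists t : R, 0 < t < 1 /\ x = (1 - t) *: v + t *: w.

Definition visible P v w : Prop := ~ (exists2 x, x \in P & blocks x v w).

(* The colouring need not be onto: at most k colours actually occur. *)
Definition k_blocked (k : nat) P : Prop :=
  exists c : P -> 'I_k, forall v w : P, v != w ->
    (visible P (val v) (val w) <-> c v != c w).

End BlockedSets.

Definition logb {R : realType} (b x : R) : R := ln x / ln b.

(* Main.v *)
(* Call a coloured family midpoint-blocked if monochromatic pairs have their
   midpoint in the family and differently coloured pairs are visible. This
   property passes to Cartesian products: a midpoint is taken coordinatewise,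
   and a point blocking two product points projects to a blocking point (or to
   a coincidence) in each factor. Hence the powers of a twelve-point
   midpoint-blocked planar lattice set, coloured by parity, are
   midpoint-blocked with 4^m colours and 12^m points in R^(2m). A generic linear
   map to the plane is injective on such a finite set and creates no new
   collinear triples, so the image is a planar example. *)
Require Import Defs.
From mathcomp Require Import all_boot all_order all_algebra.
From mathcomp Require Import finmap.
From mathcomp Require Import reals exp.
From mathcomp Require Import ring lra.

Import Order.TTheory GRing.Theory Num.Theory.
Local Open Scope ring_scope.

(** The last clause is visibility in contrapositive form. It admits [t = u], so product points that
    agree in one factor need no separate case. *)
Definition midpoint_blocked {R : numFieldType} {n : nat} {T C : finType}
    (f : T -> 'rV[R]_n) (c : T -> C) : Prop :=
  [/\ injective f,
      forall t u, c t = c u -> exists w, f w = 2^-1 *: (f t + f u) &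
      forall t u w (s : R), 0 < s < 1 ->
        f w = (1 - s) *: f t + s *: f u -> c t = c u].

Lemma midpoint_blocked_prod (R : numFieldType) (m n : nat) (T C U D : finType)
    (f : T -> 'rV[R]_m) (c : T -> C) (g : U -> 'rV[R]_n) (d : U -> D) :
  midpoint_blocked f c -> midpoint_blocked g d ->
  midpoint_blocked (fun p : T * U => row_mx (f p.1) (g p.2))
                   (fun p => (c p.1, d p.2)).
Proof.
move=> [finj fmid fvis] [ginj gmid gvis]; split.
- by move=> [t u] [t' u'] /eq_row_mx [/finj /= -> /ginj /= ->].
- move=> [t u] [t' u'] /= [/fmid [w fw] /gmid [z gz]].
  by exists (w, z); rewrite /= fw gz add_row_mx scale_row_mx.
- move=> [t u] [t' u'] [w z] s s01 /=.
  rewrite !scale_row_mx add_row_mx => /eq_row_mx [/(fvis _ _ _ _ s01) ->].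
  by move=> /(gvis _ _ _ _ s01) ->.
Qed.

Lemma exists_nonroot (R : numDomainType) (p : {poly R}) :
  p != 0 -> exists r, ~~ root p r.
Proof.
(* These [size p] candidates are distinct in characteristic zero and outnumber the possible
   roots. *)
move=> p0; pose s : seq R := [seq i%:R | i <- iota 0 (size p)].
have /allPn [r _ rP] : ~~ all (root p) s.
  apply/negP => ps; have : (size s < size p)%N.
    apply: max_poly_roots => //.
    by rewrite map_inj_uniq ?iota_uniq // => i j /eqP; rewrite eqr_nat => /eqP.
  by rewrite size_map size_iota ltnn.
by exists r.
Qed.

(** Pairing [x] with the moment vector of the powers of [r] evaluates the polynomial with
    coefficients [x] at [r], so any [r] avoiding the roots of finitely many nonzero polynomials will
    do. *)
Lemma generic_functional (R : numFieldType) (n : nat) (s : seq 'rV[R]_n) :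
  exists v : 'cV[R]_n, forall x, x \in s -> x *m v = 0 -> x = 0.
Proof.
have /exists_nonroot [r rP] : \prod_(x <- s | x != 0) rVpoly x != 0.
  rewrite prodf_seq_neq0; apply/allP => x _; apply/implyP.
  by apply: contra_neq => x0; rewrite -[x]rVpolyK x0 linear0.
exists (\col_i r ^+ i) => x xs /matrixP /(_ 0 0); rewrite !mxE => xr0.
apply/eqP/negPn/negP => x0; case/negP: rP.
rewrite (big_rem x) //= x0 rootM; apply/orP; left; apply/rootP.
rewrite -[RHS]xr0 horner_poly; apply: eq_bigr => i _.
by rewrite mxE insubT //= => Hi; congr (x 0 _ * _); apply: val_inj.
Qed.

(* If [g1] vanishes on no nonzero difference [b] of points, and [g2] on no
   nonzero [d = g1 b *: a - g1 a *: b], then [(g1, g2)] maps independent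
   differences [a], [b] to independent vectors, since their determinant is
   [- g2 d]. *)
Lemma generic_projection (R : numFieldType) (n : nat) (T : finType)
    (f : T -> 'rV[R]_n) :
  exists A : 'M[R]_(n, 2),
    (forall t u, f t *m A = f u *m A -> f t = f u) /\
    (forall t u w (s : R),
       f w *m A = (1 - s) *: (f t *m A) + s *: (f u *m A) ->
       f w = (1 - s) *: f t + s *: f u).
Proof.
have [v1 v1P] := generic_functional R n [seq f p.1 - f p.2 | p : T * T].
have {}v1P t u : (f t - f u) *m v1 = 0 -> f t - f u = 0.
  by apply: v1P; apply/imageP; exists (t, u).
pose g (v : 'cV[R]_n) (a : 'rV[R]_n) := (a *m v) 0 0.
pose d (p : T * T * T) := g v1 (f p.1.2 - f p.1.1) *: (f p.2 - f p.1.1)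
                        - g v1 (f p.2 - f p.1.1) *: (f p.1.2 - f p.1.1).
have [v2 v2P] := generic_functional R n [seq d p | p : T * T * T].
have {}v2P t u w : d (t, u, w) *m v2 = 0 -> d (t, u, w) = 0.
  by apply: v2P; apply/imageP; exists (t, u, w).
have gE v a : a *m v = (g v a)%:M by rewrite [LHS]mx11_scalar.
have A1 (a : 'rV[R]_n) b s : a *m row_mx v1 v2 = s *: (b *m row_mx v1 v2) ->
    a *m v1 = s *: (b *m v1) /\ a *m v2 = s *: (b *m v2).
  by rewrite !mul_mx_row scale_row_mx => /eq_row_mx.
exists (row_mx v1 v2); split.
  move=> t u tu; apply/eqP; rewrite -subr_eq0; apply/eqP/v1P.
  have [] := A1 (f t - f u) 0 0; last by rewrite mul0mx scaler0.
  by rewrite mulmxBl tu subrr scale0r.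
move=> t u w s e.
have [e1 e2] : (f w - f t) *m v1 = s *: ((f u - f t) *m v1) /\
               (f w - f t) *m v2 = s *: ((f u - f t) *m v2).
  apply: A1; rewrite !mulmxBl e scalerBl scale1r scalerBr.
  by rewrite addrAC (addrAC (f t *m _)) subrr add0r addrC.
suff : f w - f t = s *: (f u - f t).
  move/eqP; rewrite subr_eq => /eqP ->.
  by rewrite scalerBr scalerBl scale1r -addrA addrC (addrC (- _)).
(* If [v1] kills [f u - f t], then it kills [f w - f t] too, and both differences are zero. *)
have [b0|b0] := eqVneq (g v1 (f u - f t)) 0.
  have b1 : (f u - f t) *m v1 = 0 by rewrite gE b0 raddf0.
  by rewrite (v1P _ _ b1) scaler0; apply: v1P; rewrite e1 b1 scaler0.
have g1 : g v1 (f w - f t) = s * g v1 (f u - f t) by rewrite /g e1 mxE.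
have /v2P : d (t, u, w) *m v2 = 0.
  by rewrite /d /= mulmxBl -!scalemxAl e2 g1 scalerA mulrC subrr.
(* Now [d (t, u, w)] is the nonzero scalar [g v1 (f u - f t)] times the difference of the two sides
   of the goal. *)
rewrite /d /= g1 mulrC -scalerA -scalerBr => /eqP.
by rewrite scaler_eq0 (negPf b0) subr_eq0 => /eqP.
Qed.

Lemma midpoint_blocked_plane (R : numFieldType) (n : nat) (T C : finType)
    (f : T -> 'rV[R]_n) (c : T -> C) :
  midpoint_blocked f c -> exists g : T -> 'rV[R]_2, midpoint_blocked g c.
Proof.
move=> [finj fmid fvis]; have [A [Ainj Acol]] := generic_projection R n T f.
exists (fun t => f t *m A); split.
- by move=> t u /Ainj /finj.
- by move=> t u /fmid [w fw]; exists w; rewrite fw -scalemxAl mulmxDl.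
- by move=> t u w s s01 /Acol; apply: fvis.
Qed.

(** Each of the four parity classes contains three of these points. Equal parity makes a midpoint a
    lattice point; that it is again listed is checked by evaluation. *)
Definition twelve_points : seq (int * int) :=
  [:: (0, 1); (1, 2); (1, 5); (2, 2); (2, 3); (2, 4);
      (3, 1); (3, 2); (3, 3); (4, 0); (4, 3); (5, 4)].

Definition twelve_point (i : nat) : int * int := nth (0, 0) twelve_points i.

Definition parity (p : int * int) : bool * bool :=
  (odd `|p.1|%N, odd `|p.2|%N).

Lemma all_iota_ord {n : nat} {a : pred nat} :
  all a (iota 0 n) -> forall i : 'I_n, a i.
Proof. by move=> /allP aP i; apply: aP; rewrite mem_iota ltn_ord. Qed.

Lemma twelve_midpoint (i j : 'I_12) :
  parity (twelve_point i) = parity (twelve_point j) ->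
  exists k : 'I_12,
    (twelve_point k).1 *+ 2 = (twelve_point i).1 + (twelve_point j).1 /\
    (twelve_point k).2 *+ 2 = (twelve_point i).2 + (twelve_point j).2.
Proof.
pose mid (p q r : int * int) :=
  (r.1 *+ 2 == p.1 + q.1) && (r.2 *+ 2 == p.2 + q.2).
have H : all (fun i => all (fun j =>
  (parity (twelve_point i) == parity (twelve_point j)) ==>
  has (fun k => mid (twelve_point i) (twelve_point j) (twelve_point k))
    (iota 0 12)) (iota 0 12)) (iota 0 12) by vm_compute.
move=> /eqP ij; have := all_iota_ord (all_iota_ord H i) j.
rewrite ij => /hasP [k].
by rewrite mem_iota => /= k12 /andP [/eqP ? /eqP ?]; exists (Ordinal k12).
Qed.

(* A point strictly between [p] and [q] is collinear with them and sees them at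
   a flat angle, i.e. with positive inner product [(r - p) . (q - r)]. *)
Lemma twelve_visible (i j k : 'I_12) :
  let p := twelve_point i in let q := twelve_point j in
  let r := twelve_point k in
  (r.1 - p.1) * (q.2 - p.2) = (q.1 - p.1) * (r.2 - p.2) ->
  0 < (r.1 - p.1) * (q.1 - r.1) + (r.2 - p.2) * (q.2 - r.2) ->
  parity p = parity q.
Proof.
pose btw (p q r : int * int) :=
  ((r.1 - p.1) * (q.2 - p.2) == (q.1 - p.1) * (r.2 - p.2)) &&
  (0 < (r.1 - p.1) * (q.1 - r.1) + (r.2 - p.2) * (q.2 - r.2)).
have H : all (fun i => all (fun j => all (fun k =>
  btw (twelve_point i) (twelve_point j) (twelve_point k) ==>
  (parity (twelve_point i) == parity (twelve_point j)))
    (iota 0 12)) (iota 0 12)) (iota 0 12) by vm_compute.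
move=> p q r /eqP e lt; have := all_iota_ord (all_iota_ord (all_iota_ord H i) j) k.
by rewrite /btw e lt => /eqP.
Qed.

Lemma twelve_point_inj : injective (fun i : 'I_12 => twelve_point i).
Proof.
have u : uniq twelve_points by vm_compute.
move=> i j /eqP; rewrite (@nth_uniq _ _ twelve_points) //.
by move/eqP/val_inj.
Qed.

Lemma midpoint_blocked_twelve (R : realFieldType) :
  midpoint_blocked
    (fun i : 'I_12 => \row_(l < 2)
       (if l == 0 then (twelve_point i).1 else (twelve_point i).2)%:~R : 'rV[R]_2)
    (fun i => parity (twelve_point i)).
Proof.
have rowE (u v : 'rV[R]_2) : u 0 0 = v 0 0 -> u 0 1 = v 0 1 -> u = v.
  move=> e0 e1; apply/rowP => l.
  by have [->//|/=] := eqVneq l 0; case: l => [[|[|l]]] // Hl _;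
     rewrite (_ : Ordinal Hl = 1) //; apply: val_inj.
split.
- move=> i j /rowP e; apply: twelve_point_inj.
  have := e 0; have := e 1; rewrite !mxE /= => /intr_inj e2 /intr_inj e1.
  by rewrite [LHS]surjective_pairing e1 e2 -surjective_pairing.
- move=> i j /twelve_midpoint [k [e1 e2]]; exists k.
  by apply: rowE; rewrite !mxE /= -intrD -?e1 -?e2 rmorphMn /=; lra.
- move=> i j k s /andP [s0 s1] /rowP e.
  have := e 1; have := e 0; rewrite !mxE /=.
  have [->//|ij] := eqVneq i j.
  move: (@twelve_visible i j k) (contra_neq (@twelve_point_inj i j) ij) => /=.
  case: (twelve_point i) (twelve_point j) (twelve_point k) =>
    [a b] [a' b'] [x y] /= H ne e1 e2; apply: H.
    apply: (@intr_inj R); rewrite !intrM !intrB e1 e2; ring.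
  rewrite -(ltr0z R) intrD !intrM !intrB e1 e2.
  set A : R := a%:~R; set B : R := b%:~R; set A' : R := a'%:~R.
  set B' : R := b'%:~R.
  (* The inner product at a point dividing the segment in ratio [s : 1 - s] is [s * (1 - s)] times
     the squared length, which is positive for distinct endpoints. *)
  rewrite [ltRHS](_ : _ = s * (1 - s) * ((A' - A) ^+ 2 + (B' - B) ^+ 2));
    last by ring.
  rewrite !mulr_gt0 ?subr_gt0 // lt_neqAle addr_ge0 ?sqr_ge0 // andbT eq_sym.
  rewrite paddr_eq0 ?sqr_ge0 // !sqrf_eq0 !subr_eq0 !eqr_int.
  by rewrite -[X in ~~ X]xpair_eqE eq_sym.
Qed.

Lemma midpoint_blocked_power (R : realFieldType) (m : nat) :
  exists (n : nat) (T C : finType) (f : T -> 'rV[R]_n) (c : T -> C),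
    [/\ midpoint_blocked f c, #|T| = (12 ^ m)%N & #|C| = (4 ^ m)%N].
Proof.
elim: m => [|m [n [T [C [f [c [fP cardT cardC]]]]]]].
  (* The empty product is the single point of the zero-dimensional space, with one colour. *)
  exists 0, unit, unit, (fun=> 0), id; rewrite card_unit; split=> //; split.
  - by move=> [] [].
  - by move=> [] [] _; exists tt; rewrite addr0 scaler0.
  - by move=> [] [].
have := midpoint_blocked_prod _ _ _ _ _ _ _ _ _ _ _ (midpoint_blocked_twelve R) fP.
do 5!eexists; split; first by eassumption.
  by rewrite card_prod card_ord cardT expnS.
by rewrite !card_prod card_bool cardC expnS.
Qed.

Lemma k_blocked_midpoint_blocked (R : realType) (T C : finType)
    (f : T -> 'rV[R]_2) (c : T -> C) :
  midpoint_blocked f c -> k_blocked #|C| [fset f t | t in T]%fset.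
Proof.
move=> [finj fmid fvis]; set P := [fset f t | t in T]%fset.
have ex (p : P) : exists t, f t == val p.
  by have /imfsetP [t _ ->] := valP p; exists t.
pose pre p := xchoose (ex p); have preP p : f (pre p) = val p.
  exact/eqP/(xchooseP (ex p)).
(* A point takes the colour of its index, with the colours numbered by [enum_rank]. *)
exists (fun p => enum_rank (c (pre p))) => v w vw.
rewrite (inj_eq enum_rank_inj) -!preP; split.
  move=> vis; apply/eqP => /fmid [z fz]; apply: vis; exists (f z).
    by apply/imfsetP; exists z.
  exists 2^-1; split; first by lra.
  by rewrite fz scalerDr; congr (_ *: _ + _); lra.
move=> /eqP vis [x /imfsetP [z _ ->] [s [s01 e]]].
exact: vis (fvis _ _ _ _ s01 e).
Qed.

(** Since log_4 12 = 1 + (log_2 3) / 2, the claim amounts to 1.58 <= log_2 3 < 1.60; the two power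
    comparisons give 19/12 <= log_2 3 < 8/5. *)
Lemma logb_4_12_bounds (R : realType) :
  179%:R / 100%:R <= logb 4%:R 12%:R :> R /\
  logb 4%:R 12%:R < 180%:R / 100%:R :> R.
Proof.
have ln2 : 0 < ln 2%:R :> R by rewrite ln_gt0 ?ltr1n.
have e4 : ln 4%:R = 2%:R * ln 2%:R :> R.
  by rewrite (_ : 4%:R = 2%:R ^+ 2) ?lnXn ?ltr0n // ?mulr_natl //; ring.
have e12 : ln 12%:R = 2%:R * ln 2%:R + ln 3%:R :> R.
  by rewrite -e4 -lnM ?posrE ?ltr0n // -natrM.
(* 2^19 <= 3^12 and 3^5 < 2^8 *)
have lo : 19%:R * ln 2%:R <= 12%:R * ln 3%:R :> R.
  rewrite !mulr_natl -!lnXn ?ltr0n // ler_ln ?posrE ?exprn_gt0 ?ltr0n //.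
  by lra.
have hi : 5%:R * ln 3%:R < 8%:R * ln 2%:R :> R.
  rewrite !mulr_natl -!lnXn ?ltr0n // ltr_ln ?posrE ?exprn_gt0 ?ltr0n //.
  by lra.
rewrite /logb e4 e12 ler_pdivlMr ?ltr_pdivrMr ?mulr_gt0 ?ltr0n //.
by split; lra.
Qed.

Theorem theorem27 (R : realType) :
  (179%:R / 100%:R <= logb 4%:R 12%:R :> R) /\
  (logb 4%:R 12%:R < 180%:R / 100%:R :> R) /\
  (forall k : nat, (exists m : nat, k = (4 ^ m)%N) ->
     exists P : {fset 'rV[R]_2},
       k_blocked k P /\
       (#|` P|)%:R = k%:R `^ logb 4%:R 12%:R :> R).
Proof.
have [lo hi] := logb_4_12_bounds R; split=> //; split=> // k [m ->].
have [n [T [C [f [c [fP cardT cardC]]]]]] := midpoint_blocked_power R m.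
have [g gP] := midpoint_blocked_plane _ _ _ _ _ _ fP.
exists [fset g t | t in T]%fset; split.
  by rewrite -cardC; apply: k_blocked_midpoint_blocked gP.
have [ginj _ _] := gP.
have ln4 : ln 4%:R != 0 :> R by rewrite gt_eqF ?ln_gt0 ?ltr1n.
(* The base is nonzero, so the power is exp((ln 12 / ln 4) * m * ln 4) = exp(m * ln 12) = 12^m. *)
rewrite card_imfset //= -cardE cardT /powR /logb natrX natrX expf_eq0 pnatr_eq0 andbF.
rewrite lnXn ?ltr0n // -[ln _ *+ _]mulr_natl mulrCA divfK // expRM_natl lnK //.
by rewrite posrE ltr0n.
Qed.
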